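(* Let $G=L^{(1)}U^{(1)}=U^{(2)}L^{(2)}$ be a doubly infinite matrix with LU- and UL-decompositions, with inverses $\Lambda^{(j)}=(L^{(j)})^{-1}$, $\Upsilon^{(j)}=(U^{(j)})^{-1}$, $j=1,2$, as in the context. Assume that there exist $R>0$ and $0<\rho<1$ (independent of $p$) such that, for $i,j\in\mathbb Z$, $$|(L^{(1)}_{21}U^{(1)}_{11})_{i,j}|\le R,\qquad |(U^{(2)}_{23}L^{(2)}_{33})_{i,j}|\le R,\qquad |\Lambda^{(1)}_{i,j}|,|\Lambda^{(2)}_{i,j}|,|\Upsilon^{(1)}_{i,j}|,|\Upsilon^{(2)}_{i,j}|\le R\rho^{|i-j|}.$$ Then $$G_{22}\Big((G^{-1})_{22}-\Upsilon^{(1)}_{23}\Lambda^{(1)}_{32}-\Lambda^{(2)}_{21}\Upsilon^{(2)}_{12}\Big)=I_2+\mathcal O(p^2\rho^p),\qquad p\to\infty,$$ where the error term is with respect to the standard matrix norm. Moreover, for $i,j=1,\ldots,n+p$, $$\big((G_{22})^{-1}\big)_{-p+i-1,-p+j-1}=(\Lambda^{(2)}_{22}\Upsilon^{(2)}_{22})_{-p+i-1,-p+j-1}+\mathcal O(p^2\rho^p)$$ and $$\big((G_{22})^{-1}\big)_{n-i,n-j}=(\Upsilon^{(1)}_{22}\Lambda^{(1)}_{22})_{n-i,n-j}+\mathcal O(p^2\rho^p),$$ as $p\to\infty$.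
   Context: Matrices are indexed by $\mathbb Z\times\mathbb Z$. $G$ is a matrix with $G=L^{(1)}U^{(1)}=U^{(2)}L^{(2)}$, where $L^{(1)},L^{(2)}$ are lower triangular and $U^{(1)},U^{(2)}$ are upper triangular. All four are assumed invertible, with inverses $\Lambda^{(j)}=(L^{(j)})^{-1}$ lower triangular and $\Upsilon^{(j)}=(U^{(j)})^{-1}$ upper triangular, and $G^{-1}=\Upsilon^{(1)}\Lambda^{(1)}=\Lambda^{(2)}\Upsilon^{(2)}$. The positive integer $n$ is fixed. For each positive integer $p$ every such matrix $A$ is decomposed into nine blocks $A=(A_{kl})_{k,l=1}^3$ according to the partition of $\mathbb Z$ into $\{i<-p\}$ (block 1), $\{-p,\dots,n-1\}$ (block 2) and $\{i\ge n\}$ (block 3). So $A_{22}$ is the $(n+p)\times(n+p)$ matrix $(A_{i,j})_{i,j=-p}^{n-1}$; entries of blocks keep their original indices in $\mathbb Z$. $I_2$ is the identity matrix of size $n+p$.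
   Formalization: Products are entrywise convergent series; associativity of the triples L^(1),U^(1),Υ^(1) and U^(2),L^(2),Λ^(2) is assumed, since the claim fails without it. In the entrywise claims i,j≥1 are fixed and the O-constants may depend on i,j (uniformity is false). *)

(* Defs.v *)
From HB Require Import structures.
From mathcomp Require Export all_boot all_order all_algebra.
From mathcomp Require Export complex.
From mathcomp Require Export all_classical all_reals all_analysis.
Set Implicit Arguments.
Unset Strict Implicit.
Unset Printing Implicit Defensive.
Export Order.TTheory GRing.Theory Num.Theory.
Export numFieldNormedType.Exports.
Export ComplexField.Normc.
Local Open Scope classical_set_scope.
Local Open Scope ring_scope.
Local Open Scope complex_scope.

Definition zmatrix (R : realType) := int -> int -> R[i].

(* A series over Z converges when its two halves, over k = 0, 1, 2, ... and
   over k = -1, -2, -3, ..., both converge (conditional convergence is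
   allowed).  Limits are taken in R[i]^o, i.e., in R[i] with the topology given
   by its modulus. *)
Definition zseries_pos (R : realType) (u : int -> R[i]) : nat -> R[i]^o :=
  series (fun k : nat => u k%:Z : R[i]^o).

Definition zseries_neg (R : realType) (u : int -> R[i]) : nat -> R[i]^o :=
  series (fun k : nat => u (- k.+1%:Z) : R[i]^o).

Definition zsummable (R : realType) (u : int -> R[i]) : Prop :=
  cvgn (zseries_pos u) /\ cvgn (zseries_neg u).

Definition zsum (R : realType) (u : int -> R[i]) : R[i] :=
  limn (zseries_pos u) + limn (zseries_neg u).

(* Without convergence the entries of [zmul A B] are junk limits: hypotheses
   on products go through [is_zmul]. *)
Definition zmul (R : realType) (A B : zmatrix R) : zmatrix R :=
  fun i j => zsum (fun k => A i k * B k j).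

Definition is_zmul (R : realType) (A B C : zmatrix R) : Prop :=
  forall i j : int,
    zsummable (fun k => A i k * B k j) /\ zmul A B i j = C i j.

Definition zone (R : realType) : zmatrix R := fun i j => (i == j)%:R.

Definition is_zinv (R : realType) (A B : zmatrix R) : Prop :=
  is_zmul A B (zone R) /\ is_zmul B A (zone R).

(* (A B) C = A (B C), all four products being convergent.  This is not
   automatic for infinite matrices, not even for triangular factors: with S the
   shift (S_{i,i+1} = 1) and 0 < r < 1, take A = \sum_(k >= 0) r^-k S^-k,
   B = I - r S and C = B^-1 = \sum_(k >= 0) r^k S^k.  Then A B = - r S, so
   (A B) C is strictly upper triangular, while A (B C) = A. *)
Definition zassoc (R : realType) (A B C : zmatrix R) : Prop :=
  exists AB BC D : zmatrix R,
    [/\ is_zmul A B AB, is_zmul AB C D, is_zmul B C BC & is_zmul A BC D].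

Definition lower_tri (R : realType) (A : zmatrix R) : Prop :=
  forall i j : int, i < j -> A i j = 0.

Definition upper_tri (R : realType) (A : zmatrix R) : Prop :=
  forall i j : int, j < i -> A i j = 0.

Definition in_block (n p k : nat) (i : int) : bool :=
  match k with
  | 1%N => i < - p%:Z
  | 2%N => (- p%:Z <= i) && (i < n%:Z)
  | 3%N => n%:Z <= i
  | _ => false
  end.

(* The block A_{kl}, extended by zero to all of Z x Z, so that products of
   blocks are products of matrices indexed by Z x Z. *)
Definition block (R : realType) (n p k l : nat) (A : zmatrix R) : zmatrix R :=
  fun i j => if in_block n p k i && in_block n p l j then A i j else 0.

(* Row (or column) r of an (n + p) x (n + p) matrix has original index r - p. *)
Definition idx22 (n p : nat) (r : 'I_(n + p)) : int := (r : nat)%:Z - p%:Z.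

Definition mx22 (R : realType) (n p : nat) (A : zmatrix R) : 'M[R[i]]_(n + p) :=
  \matrix_(r, s) A (idx22 r) (idx22 s).

(* The entry of M at original indices (a, b); at most one term is summed. *)
Definition entry22 (R : realType) (n p : nat) (M : 'M[R[i]]_(n + p))
    (a b : int) : R[i] :=
  \sum_(r | idx22 r == a) \sum_(s | idx22 s == b) M r s.

Definition l2norm (R : realType) (m : nat) (x : 'cV[R[i]]_m) : R :=
  Num.sqrt (\sum_(i < m) normc (x i ord0) ^+ 2).

Definition opnorm (R : realType) (m : nat) (M : 'M[R[i]]_m) : R :=
  sup [set l2norm (M *m x) | x in [set x : 'cV[R[i]]_m | l2norm x <= 1]].

(* Main.v *)
Require Import Defs.
From mathcomp Require Import ring lra zify.
Set Implicit Arguments.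
Unset Strict Implicit.
Unset Printing Implicit Defensive.
Local Open Scope classical_set_scope.
Local Open Scope ring_scope.
Local Open Scope complex_scope.

(** Fix p > 0, let i and j be indices of block 2, and put, for every integer k,
      v_kj = sum over l >= n of Ups1_kl Lam1_lj,
      w_kj = sum over l < -p of Lam2_kl Ups2_lj,
      T = Ginv - v - w,
    so that the block T_22 is the matrix that multiplies G_22 in the first
    claim ([corrected_inverse]).

    The rows G_i. with i in block 2 are bounded: G_21 = L1_21 U1_11 and
    G_23 = U2_23 L2_33 by triangularity, which the hypotheses bound by C
    ([off_block_le]), and the remaining entries are finitely many.  Associativity
    gives G Ups1 = L1 and G Lam2 = U2 ([zassoc_cancel]).  Since a bounded row
    times exponentially decaying factors can be summed in either order
    ([zlim_exchange], [partial_zmul_annihilated]),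
      sum_k G_ik v_kj = sum over l >= n of L1_il Lam1_lj = 0   because i < n <= l,
      sum_k G_ik w_kj = sum over l < -p of U2_il Ups2_lj = 0   because l < -p <= i,
    hence sum_k G_ik T_kj = delta_ij.  So E = G_22 T_22 - 1 is minus the part of
    that sum with k outside block 2.  There T is small: triangularity gives
    Ginv = w on rows k < -p and Ginv = v on rows k >= n, so T is -v, respectively
    -w, and the index l of the remaining sum is at distance at least p + |k + p|,
    respectively p + |k - n|, from k.  Summing the geometric weights gives
    |E_ij| <= c rho^p ([truncated_product_error]).

    The rest is perturbation theory in dimension n + p = O(p).  The norm of E is
    at most (n + p)^2 c rho^p ([opnorm_le]).  As soon as (n + p) c rho^p <= 1/2,
    G_22 is invertible, and Y = G_22^-1 satisfies Y = T_22 - Y E, which bounds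
    Y - T_22 entrywise by O(p rho^p) ([approx_right_inverse]).  Finally
    T_22 = Lam2_22 Ups2_22 - v_22 = Ups1_22 Lam1_22 - w_22, and v is O(rho^p) on
    a row at fixed distance from -p, as w is on a row at fixed distance from n. *)

(** * The modulus and series over the integers *)

Lemma normc_ge0 (R : realType) (x : R[i]) : 0 <= normc x.
Proof. by case: x => a b; exact: sqrtr_ge0. Qed.

Lemma normcB (R : realType) (x y : R[i]) : normc (x - y) = normc (y - x).
Proof. by rewrite -opprB normcN. Qed.

Lemma normc_sum (R : realType) (I : Type) (r : seq I) (P : pred I)
    (F : I -> R[i]) :
  normc (\sum_(i <- r | P i) F i) <= \sum_(i <- r | P i) normc (F i).
Proof.
elim/big_rec2: _ => [|i y x _ IH]; first by rewrite normc0.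
by apply: le_trans (le_normcD _ _) _; rewrite lerD2l.
Qed.

Lemma normc_le_ReIm (R : realType) (x : R[i]) :
  normc x <= `|complex.Re x| + `|complex.Im x|.
Proof.
case: x => a b /=; rewrite -(ger0_norm (addr_ge0 (normr_ge0 a) (normr_ge0 b))).
rewrite -sqrtr_sqr ler_sqrt ?sqr_ge0// sqrrD !real_normK ?num_real//.
by rewrite lerD2r lerDl mulrn_wge0 ?mulr_ge0.
Qed.

Lemma normc_ReIm_le (R : realType) (x : R[i]) :
  `|complex.Re x| <= normc x /\ `|complex.Im x| <= normc x.
Proof.
case: x => a b /=; rewrite -!sqrtr_sqr !ler_sqrt ?addr_ge0 ?sqr_ge0//.
by rewrite lerDl lerDr !sqr_ge0.
Qed.

(** Symmetric partial sums: a single sequence that converges to the sum of a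
    two-sided series as soon as both halves converge. *)
Definition zpsum (V : nmodType) (u : int -> V) (N : nat) : V :=
  \sum_(k < N) u k%:Z + \sum_(k < N) u (- k.+1%:Z).

(** The distance to the limit is real-valued, so that order and squeezing
    arguments take place in [R] rather than in [R[i]]. *)
Definition zlim (R : realType) (u : int -> R[i]) (s : R[i]) : Prop :=
  (fun N => normc (zpsum u N - s)) @ \oo --> (0 : R).

Lemma cvg_normcP (R : realType) (u : nat -> R[i]) (l : R[i]) :
  (fun N => u N : R[i]^o) @ \oo --> (l : R[i]^o) <->
  (fun N => normc (u N - l)) @ \oo --> (0 : R).
Proof.
split.
- move=> /cvgrPdist_lt h; apply/cvgrPdist_lt => e e0.
  have e0' : 0 < e%:C :> R[i] by rewrite ltcR.
  near=> N.
  rewrite sub0r normrN ger0_norm ?normc_ge0// -ltcR.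
  have : `|l - u N| < e%:C by near: N; exact: h.
  by rewrite distrC normc_def; case: (u N - l).
- move=> /cvgrPdist_lt h; apply/cvgrPdist_lt => -[e e'].
  rewrite ltcE /= => /andP[/eqP e'0 e0]; subst e'.
  near=> N.
  have : `|0 - normc (u N - l)| < e by near: N; exact: h.
  rewrite sub0r normrN ger0_norm ?normc_ge0// -ltcR distrC normc_def.
  by case: (u N - l).
Unshelve. all: by end_near. Qed.

Lemma zsum_zlim (R : realType) (u : int -> R[i]) :
  zsummable u -> zlim u (zsum u).
Proof.
move=> [up un]; apply/cvg_normcP.
have -> : (fun N => zpsum u N : R[i]^o) = zseries_pos u \+ zseries_neg u.
  apply/funext => N.
  by rewrite /zseries_pos /zseries_neg /series/= /zpsum !big_mkord.
have h := @cvgD _ R[i]^o nat \oo _ _ _ _ _ up un.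
Timeout 20 exact: h.
Qed.

Lemma zlimD (R : realType) (u v : int -> R[i]) (s t : R[i]) :
  zlim u s -> zlim v t -> zlim (fun k => u k + v k) (s + t).
Proof.
move=> /cvg_normcP us /cvg_normcP vt; apply/cvg_normcP.
have -> : (fun N => zpsum (fun k => u k + v k) N : R[i]^o) =
    (fun N => zpsum u N : R[i]^o) \+ (fun N => zpsum v N : R[i]^o).
  by apply/funext => N; rewrite /zpsum /= !big_split/= addrACA.
have h := @cvgD _ R[i]^o nat \oo _ _ _ _ _ us vt.
Timeout 20 exact: h.
Qed.

Lemma zlimN (R : realType) (u : int -> R[i]) (s : R[i]) :
  zlim u s -> zlim (fun k => - u k) (- s).
Proof.
rewrite /zlim => us.
under eq_fun => N do rewrite /zpsum !sumrN -opprD -opprD normcN.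
exact: us.
Qed.

Lemma zlimB (R : realType) (u v : int -> R[i]) (s t : R[i]) :
  zlim u s -> zlim v t -> zlim (fun k => u k - v k) (s - t).
Proof. by move=> us vt; apply: zlimD us _; apply: zlimN. Qed.

Lemma zlimZ (R : realType) (c : R[i]) (u : int -> R[i]) (s : R[i]) :
  zlim u s -> zlim (fun k => c * u k) (c * s).
Proof.
rewrite /zlim => us.
have : (fun N => normc c * normc (zpsum u N - s)) @ \oo --> (0 : R).
  by rewrite -(mulr0 (normc c)); apply: cvgMr.
apply: cvg_trans; apply: near_eq_cvg; near=> N.
by rewrite /zpsum -!mulr_sumr -mulrDr -mulrBr normcM.
Unshelve. all: by end_near. Qed.

Lemma zlim0 (R : realType) : zlim (fun=> 0 : R[i]) 0.
Proof.
rewrite /zlim; apply: cvg_near_cst; near=> N.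
by rewrite /zpsum !big1// addr0 subr0 normc0.
Unshelve. all: by end_near. Qed.

Lemma zlim_sum (R : realType) (I : Type) (r : seq I) (u : I -> int -> R[i])
    (s : I -> R[i]) :
  (forall i, zlim (u i) (s i)) ->
  zlim (fun k => \sum_(i <- r) u i k) (\sum_(i <- r) s i).
Proof.
move=> us; elim: r => [|i r IH].
  by rewrite big_nil; under eq_fun do rewrite big_nil; exact: zlim0.
by rewrite big_cons; under eq_fun do rewrite big_cons; exact: zlimD.
Qed.

Lemma zlim_zpsum (R : realType) (u : int -> int -> R[i]) (s : int -> R[i])
    (N : nat) :
  (forall i, zlim (u i) (s i)) ->
  zlim (fun k => zpsum (u^~ k) N) (zpsum s N).
Proof. by move=> us; apply: zlimD; apply: zlim_sum. Qed.

Lemma zlim_eventually (R : realType) (u : int -> R[i]) (s : R[i]) (N0 : nat) :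
  (forall N, (N0 <= N)%N -> zpsum u N = s) -> zlim u s.
Proof.
move=> us; rewrite /zlim; apply: cvg_near_cst; near=> N.
rewrite us ?subrr ?normc0//; near: N; exact: nbhs_infty_ge.
Unshelve. all: by end_near. Qed.

Lemma normc_zpsum (R : realType) (u : int -> R[i]) (a : int -> R) (N : nat) :
  (forall k, normc (u k) <= a k) -> normc (zpsum u N) <= zpsum a N.
Proof.
move=> ua; apply: le_trans (le_normcD _ _) _; rewrite lerD//.
- by apply: le_trans (normc_sum _ _ _) _; apply: ler_sum.
- by apply: le_trans (normc_sum _ _ _) _; apply: ler_sum.
Qed.

Lemma normc_lim_le (R : realType) (u : nat -> R[i]) (s : R[i]) (A : R)
    (N0 : nat) :
  (fun N => normc (u N - s)) @ \oo --> (0 : R) ->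
  (forall N, (N0 <= N)%N -> normc (u N) <= A) -> normc s <= A.
Proof.
move=> us uA; apply/ler_addgt0Pr => e e0.
move/cvgrPdist_lt : us => /(_ e e0) us.
near \oo => N.
have h1 : normc (u N - s) < e.
  have : `|0 - normc (u N - s)| < e by near: N.
  by rewrite sub0r normrN ger0_norm ?normc_ge0.
have h2 : normc (u N) <= A by apply: uA; near: N; exact: nbhs_infty_ge.
rewrite -(subrK (u N) s).
apply: le_trans (le_normcD _ _) _; rewrite addrC normcB.
by apply: lerD => //; exact: ltW.
Unshelve. all: by end_near. Qed.

Lemma zlim_le (R : realType) (u : int -> R[i]) (s : R[i]) (a : int -> R) (A : R) :
  zlim u s -> (forall k, normc (u k) <= a k) ->
  (forall N, zpsum a N <= A) -> normc s <= A.
Proof.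
move=> us ua aA; apply: (@normc_lim_le _ _ _ _ 0%N us) => N _.
exact: le_trans (normc_zpsum _ ua) (aA N).
Qed.

Lemma zlim_unique (R : realType) (u : int -> R[i]) (s t : R[i]) :
  zlim u s -> zlim u t -> s = t.
Proof.
move=> us ut; apply/eqP; rewrite -subr_eq0; apply/eqP; apply: eq0_normc.
apply/eqP; rewrite eq_le normc_ge0 andbT.
apply: (zlim_le (a := fun=> 0) (zlimB us ut)) => [k|N].
  by rewrite subrr normc0.
by rewrite /zpsum !big1// addr0.
Qed.

(** Absolute convergence: completeness of [R] is applied to the real and
    imaginary parts separately. *)
Lemma cvg_series_normc (R : realType) (u : nat -> R[i]) (a : nat -> R) (A : R) :
  (forall k, normc (u k) <= a k) -> (forall N, \sum_(k < N) a k <= A) ->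
  cvgn (series (fun k => u k : R[i]^o)).
Proof.
move=> ua aA.
have a0 k : 0 <= a k by exact: le_trans (normc_ge0 _) (ua k).
have ca : cvgn (series a).
  apply: nondecreasing_is_cvgn; first exact: nondecreasing_series.
  by exists A => _ [N _ <-]; rewrite /series/= big_mkord.
have cvgpart (f : R[i] -> R) : (forall z, `|f z| <= normc z) ->
    cvgn (series (fun k => f (u k))).
  move=> fn; apply: normed_cvg; apply: series_le_cvg ca => // k /=.
    exact: normr_ge0.
  exact: le_trans (fn _) (ua k).
have /cvg_ex[x ux] := cvgpart _ (fun z => (normc_ReIm_le z).1).
have /cvg_ex[y uy] := cvgpart _ (fun z => (normc_ReIm_le z).2).
apply/cvg_ex; exists ((x +i* y)%C : R[i]^o).
apply/(cvg_normcP (series u)).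
have : (fun N => `|series (fun k => complex.Re (u k)) N - x| +
   `|series (fun k => complex.Im (u k)) N - y|) @ \oo --> (0 : R).
  rewrite -(addr0 0); apply: cvgD; rewrite -[X in _ --> X](@normr0 _ R).
  - by apply: cvg_norm; rewrite -(subrr x); apply: cvgB => //; exact: cvg_cst.
  - by apply: cvg_norm; rewrite -(subrr y); apply: cvgB => //; exact: cvg_cst.
move=> h; apply: (squeeze_cvgr _ (cvg_cst 0) h); near=> N.
rewrite normc_ge0/=; apply: le_trans (normc_le_ReIm _) _.
by rewrite !raddfB/= /series/= !raddf_sum.
Unshelve. all: by end_near. Qed.

Lemma zsummable_dominated (R : realType) (u : int -> R[i]) (a : int -> R) (A : R) :
  (forall k, normc (u k) <= a k) -> (forall N, zpsum a N <= A) -> zsummable u.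
Proof.
move=> ua aA.
have a0 k : 0 <= a k by exact: le_trans (normc_ge0 _) (ua k).
split; [apply: (@cvg_series_normc _ _ (fun k => a k%:Z) A)
      | apply: (@cvg_series_normc _ _ (fun k => a (- k.+1%:Z)) A)] => // N;
  apply: le_trans (aA N); rewrite /zpsum ?lerDl ?lerDr; exact: sumr_ge0.
Qed.

Lemma zpsum_tail (R : realType) (u : int -> R[i]) (a : int -> R) (N M : nat) :
  (N <= M)%N -> (forall k, normc (u k) <= a k) ->
  normc (zpsum u M - zpsum u N) <= zpsum a M - zpsum a N.
Proof.
move=> NM ua.
have split_ (V : zmodType) (w : int -> V) : zpsum w M - zpsum w N =
    \sum_(N <= k < M) w k%:Z + \sum_(N <= k < M) w (- k.+1%:Z).
  rewrite /zpsum -!(big_mkord xpredT (fun k : nat => w k)).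
  rewrite -!(big_mkord xpredT (fun k : nat => w (- k.+1%:Z))).
  rewrite opprD addrACA.
  rewrite !(@big_cat_nat _ _ _ N 0 M)//=.
  have cancel_head (x y : V) : x + y - x = y by rewrite addrC addKr.
  by rewrite !cancel_head.
rewrite !split_; apply: le_trans (le_normcD _ _) _; rewrite lerD//.
- by apply: le_trans (normc_sum _ _ _) _; apply: ler_sum.
- by apply: le_trans (normc_sum _ _ _) _; apply: ler_sum.
Qed.

Lemma zpsum_cvg (R : realType) (a : int -> R) (A : R) :
  (forall k, 0 <= a k) -> (forall N, zpsum a N <= A) -> cvgn (zpsum a).
Proof.
move=> a0 aA; apply: nondecreasing_is_cvgn; last by exists A => _ [N _ <-].
apply/nondecreasing_seqP => N.
rewrite /zpsum !big_ord_recr/= lerD// lerDl//.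
Qed.

(** A Fubini theorem for families dominated by a product a_k b_l.  The difference
    between the partial sum over k of the row sums and s is a sum over l of tails
    in k, each at most b_l times a tail of the series of a; so it is at most B
    times that tail, and tends to 0. *)
Lemma zlim_exchange (R : realType) (f : int -> int -> R[i]) (v w : int -> R[i])
    (a b : int -> R) (A B : R) (s : R[i]) :
  (forall k l, normc (f k l) <= a k * b l) ->
  (forall k, 0 <= a k) -> (forall l, 0 <= b l) ->
  (forall N, zpsum a N <= A) -> (forall N, zpsum b N <= B) ->
  (forall k, zlim (f k) (v k)) -> (forall l, zlim (f^~ l) (w l)) ->
  zlim w s -> zlim v s.
Proof.
move=> fab a0 b0 aA bB fv fw ws.
have /cvg_ex[A' aA'] := zpsum_cvg a0 aA.
have leA' N : zpsum a N <= A'.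
  have /cvg_lim <- // := aA'.
  apply: nondecreasing_cvgn_le; last exact: zpsum_cvg aA.
  by apply/nondecreasing_seqP => k; rewrite /zpsum !big_ord_recr/= lerD// lerDl.
(* A' is the sum of a, so A' - zpsum a N is its tail. *)
have bound N : normc (zpsum v N - s) <= (A' - zpsum a N) * B.
  have tail_ge0 : 0 <= A' - zpsum a N by rewrite subr_ge0; exact: leA'.
  have h : zlim (fun l => zpsum (f^~ l) N - w l) (zpsum v N - s).
    by apply: zlimB ws; exact: zlim_zpsum.
  apply: (zlim_le (a := fun l => (A' - zpsum a N) * b l) h) => [l|M]; last first.
    rewrite [X in X <= _](_ : _ = (A' - zpsum a N) * zpsum b M).
      by rewrite ler_wpM2l.
    by rewrite /zpsum mulrDr !mulr_sumr.
  rewrite normcB; set fl := f^~ l.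
  apply: (@normc_lim_le _ (fun M => zpsum fl M - zpsum fl N) _ _ N).
    have := fw l; apply: cvg_trans; apply: near_eq_cvg; near=> M.
    by rewrite opprB addrA subrK.
  move=> M NM.
  apply: le_trans (zpsum_tail NM (fun k => fab k l)) _.
  rewrite [X in X <= _](_ : _ = (zpsum a M - zpsum a N) * b l).
    by rewrite ler_wpM2r// lerB//; exact: leA'.
  by rewrite mulrBl /zpsum !mulrDl !mulr_suml.
have h0 : (fun N => (A' - zpsum a N) * B) @ \oo --> (0 : R).
  rewrite -(mul0r B); apply: cvgMl; rewrite -(subrr A').
  by apply: cvgB => //; exact: cvg_cst.
apply: (squeeze_cvgr _ (cvg_cst 0) h0); near=> N.
by rewrite normc_ge0/=.
Unshelve. all: by end_near. Qed.

(** * Geometric weights and finite windows *)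

Lemma sum_geometric_le (R : realType) (r : R) (N : nat) :
  0 < r -> r < 1 -> \sum_(k < N) r ^+ k <= (1 - r)^-1.
Proof.
move=> r0 r1; have r1' : 0 < 1 - r by rewrite subr_gt0.
rewrite -(ler_pM2l r1') divff ?gt_eqF// -[X in X <= _]opprK -mulNr opprB.
by rewrite -subrX1 opprB gerBl exprn_ge0// ltW.
Qed.

Lemma sum_two_sided_geometric_le (R : realType) (r : R) (a : int) (N : nat) :
  0 < r -> r < 1 -> \sum_(k < N) r ^+ `|k%:Z - a|%N <= 2 / (1 - r).
Proof.
move=> r0 r1; have r0' := ltW r0.
have K0 : 0 <= (1 - r)^-1 by rewrite invr_ge0 subr_ge0 ltW.
(* For a >= 0 the terms left of a form the first sum; for a < 0, m = 0. *)
suff [m h] : exists m : nat, \sum_(k < N) r ^+ `|k%:Z - a|%N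
    <= \sum_(t < m) r ^+ t.+1 + (1 - r)^-1.
  apply: le_trans h _; rewrite mulr_natl mulr2n lerD2r.
  apply: le_trans (sum_geometric_le m r0 r1); apply: ler_sum => t _.
  by rewrite exprS ler_piMl ?exprn_ge0// ltW.
case: a => m.
- exists m; elim: m N => [|m IH] N.
    rewrite big_ord0 add0r; under eq_bigr do rewrite subr0.
    exact: sum_geometric_le.
  case: N => [|N].
    by rewrite big_ord0 addr_ge0// sumr_ge0// => t _; rewrite exprn_ge0.
  rewrite big_ord_recl big_ord_recr/= addrAC [X in _ <= X]addrC lerD//.
    by rewrite subn0.
  apply: le_trans (IH N); apply: ler_sum => k _.
  by rewrite (_ : absz _ = `|k%:Z - m|%N)//; rewrite /bump/=; lia.
- exists 0%N; rewrite big_ord0 add0r.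
  apply: le_trans (sum_geometric_le N r0 r1); apply: ler_sum => k _.
  by apply: ler_wiXn2l => //; [exact: ltW | lia].
Qed.

Lemma zpsum_two_sided_geometric_le (R : realType) (r : R) (a : int) (N : nat) :
  0 < r -> r < 1 ->
  zpsum (fun k => r ^+ `|k - a|%N) N <= 4 / (1 - r).
Proof.
move=> r0 r1.
rewrite (_ : 4 = 2 + 2 :> R); last by rewrite -natrD.
rewrite mulrDl lerD ?sum_two_sided_geometric_le//.
apply: le_trans (sum_two_sided_geometric_le (- 1 - a) N r0 r1).
apply: ler_sum => k _.
by rewrite (_ : absz _ = absz (k%:Z - (-1 - a))%R)//; lia.
Qed.

Lemma zpsumZ (R : realType) (c : R) (a : int -> R) (N : nat) :
  zpsum (fun k => c * a k) N = c * zpsum a N.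
Proof. by rewrite /zpsum mulrDr !mulr_sumr. Qed.

Lemma zpsumD (V : nmodType) (a b : int -> V) (N : nat) :
  zpsum (fun k => a k + b k) N = zpsum a N + zpsum b N.
Proof. by rewrite /zpsum !big_split addrACA. Qed.

Lemma zpsum_weight_le (R : realType) (c r : R) (a : int) (N : nat) :
  0 <= c -> 0 < r -> r < 1 ->
  zpsum (fun k => c * r ^+ `|k - a|%N) N <= c * (4 / (1 - r)).
Proof.
by move=> c0 r0 r1; rewrite zpsumZ ler_wpM2l// zpsum_two_sided_geometric_le.
Qed.

(** Identifies the entries of products of finite blocks with sums over Z, so that
    they can be compared with the entries of products of infinite matrices. *)
Lemma zlim_window (R : realType) (n p : nat) (u : int -> R[i]) :
  zlim (fun k => if in_block n p 2 k then u k else 0)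
       (\sum_(r < n + p) u (idx22 r)).
Proof.
apply: (@zlim_eventually _ _ _ (n + p)) => N npN.
rewrite /zpsum /idx22 -(big_mkord xpredT (fun r => u (r%:Z - p%:Z))).
rewrite (@big_cat_nat _ _ _ p) ?leq_addl//= addrC; congr (_ + _).
- rewrite -{2}(add0n p) big_addn addnK.
  rewrite -(big_mkord xpredT (fun k => if (_ <= k%:Z) && (k%:Z < _) then u k else 0)).
  rewrite (@big_cat_nat _ _ _ n 0 N)//=; last by lia.
  rewrite [X in _ + X]big_nat_cond [X in _ + X]big1 ?addr0.
    apply: eq_big_nat => k kn; rewrite ifT; last by lia.
    by congr u; lia.
  by move=> k kN; rewrite ifF//; lia.
- rewrite -(big_mkord xpredT (fun k => if (_ <= - k.+1%:Z) && (- k.+1%:Z < _)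
     then u (- k.+1%:Z) else 0)).
  rewrite (@big_cat_nat _ _ _ p 0 N)//=; last by lia.
  rewrite [X in _ + X]big_nat_cond [X in _ + X]big1 ?addr0.
    rewrite [RHS]big_nat_rev/=.
    apply: eq_big_nat => k kn; rewrite ifT; last by lia.
    by congr u; lia.
  by move=> k kN; rewrite ifF//; lia.
Qed.

Lemma zlim_point (R : realType) (u : int -> R[i]) (j : int) :
  zlim (fun k => u k * (k == j)%:R) (u j).
Proof.
have off k : k != j -> u k * (k == j)%:R = 0 by move=> /negbTE ->; rewrite mulr0.
apply: (@zlim_eventually _ _ _ `|j|.+1) => N jN; rewrite /zpsum.
case: j off jN => j off jN; have jN' : (j < N)%N by lia.
- rewrite (bigD1 (Ordinal jN'))//= eqxx mulr1 !big1 ?addr0//.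
  + by move=> k _; apply: off; lia.
  + by move=> k kj; apply: off; apply: contra kj => /eqP[kj]; apply/eqP/val_inj.
- rewrite addrC (bigD1 (Ordinal jN'))//= -NegzE eqxx mulr1 !big1 ?addr0//.
  + by move=> k _; apply: off; lia.
  + move=> k kj; apply: off; apply: contra kj => /eqP kj.
    by apply/eqP/val_inj => /=; lia.
Qed.

(** * Products of infinite matrices *)

Lemma is_zmul_zlim (R : realType) (A B D : zmatrix R) (i j : int) :
  is_zmul A B D -> zlim (fun k => A i k * B k j) (D i j).
Proof. by move=> /(_ i j)[AB <-]; exact: zsum_zlim. Qed.

Lemma is_zmul_eq (R : realType) (A B D E : zmatrix R) :
  is_zmul A B D -> is_zmul A B E -> D = E.
Proof.
move=> AD AE; apply/funext => i; apply/funext => j.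
by rewrite -(AD i j).2 -(AE i j).2.
Qed.

Lemma is_zmul1_eq (R : realType) (A D : zmatrix R) :
  is_zmul A (zone R) D -> D = A.
Proof.
move=> AD; apply/funext => i; apply/funext => j.
exact: zlim_unique (is_zmul_zlim i j AD) (zlim_point (A i) j).
Qed.

(** (A B) B' = A (B B') = A; associativity has to be assumed because nothing is
    known about the growth of A and B. *)
Lemma zassoc_cancel (R : realType) (A B B' G : zmatrix R) :
  zassoc A B B' -> is_zmul A B G -> is_zinv B B' -> is_zmul G B' A.
Proof.
move=> [AB [BC [D [hAB hD hBC hD']]]] hG [hB _].
have eAB := is_zmul_eq hAB hG; have eBC := is_zmul_eq hBC hB; subst AB BC.
by rewrite -(is_zmul1_eq hD').
Qed.

Definition exp_decay (R : realType) (C rho : R) (A : zmatrix R) : Prop :=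
  forall i j : int, normc (A i j) <= C * rho ^+ `|i - j|%N.

(** The product of the blocks A_{.t} B_{t.}, with P the membership in block t,
    but defined for all row and column indices: rows outside the block 2 occur
    in the proof. *)
Definition partial_zmul (R : realType) (P : int -> bool) (A B : zmatrix R) :
    zmatrix R :=
  fun k j => zsum (fun l => if P l then A k l * B l j else 0).

Lemma exp_decay_mul_le (R : realType) (C rho : R) (A B : zmatrix R)
    (k l j : int) :
  exp_decay C rho A -> exp_decay C rho B ->
  normc (A k l * B l j) <= C ^+ 2 * (rho ^+ `|k - l|%N * rho ^+ `|l - j|%N).
Proof.
move=> dA dB; rewrite normcM.
apply: le_trans (ler_pM (normc_ge0 _) (normc_ge0 _) (dA k l) (dB l j)) _.
by rewrite expr2 mulrACA.
Qed.

Lemma partial_zmul_dominated (R : realType) (C rho : R) (A B : zmatrix R)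
    (P : int -> bool) (k j : int) (q : nat) :
  0 < rho -> rho < 1 -> exp_decay C rho A -> exp_decay C rho B ->
  (forall l, P l -> (q <= `|k - l|)%N) ->
  forall l, normc (if P l then A k l * B l j else 0)
    <= C ^+ 2 * rho ^+ q * rho ^+ `|l - j|%N.
Proof.
move=> r0 r1 dA dB hc l; have r0' := ltW r0; case: ifP => [Pl|_].
  apply: le_trans (exp_decay_mul_le k l j dA dB) _.
  rewrite mulrA ler_wpM2r ?exprn_ge0// ler_wpM2l ?sqr_ge0//.
  by apply: ler_wiXn2l => //; [exact: ltW | exact: hc].
by rewrite normc0 -mulrA mulr_ge0 ?sqr_ge0// mulr_ge0 ?exprn_ge0.
Qed.

Lemma partial_zmul_zlim (R : realType) (C rho : R) (A B : zmatrix R)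
    (P : int -> bool) (k j : int) :
  0 < rho -> rho < 1 -> exp_decay C rho A -> exp_decay C rho B ->
  zlim (fun l => if P l then A k l * B l j else 0) (partial_zmul P A B k j).
Proof.
move=> r0 r1 dA dB; apply: zsum_zlim.
apply: (zsummable_dominated (A := C ^+ 2 * rho ^+ 0 * (4 / (1 - rho)))
   (partial_zmul_dominated j (q := 0) r0 r1 dA dB _)) => [//|N].
by apply: zpsum_weight_le => //; rewrite mulr_ge0 ?sqr_ge0 ?exprn_ge0// ltW.
Qed.

(** If the summation index stays at distance at least q from k, the decay of A
    yields a factor rho^q, and that of B makes the sum converge. *)
Lemma partial_zmul_le (R : realType) (C rho : R) (A B : zmatrix R)
    (P : int -> bool) (k j : int) (q : nat) :
  0 < rho -> rho < 1 -> exp_decay C rho A -> exp_decay C rho B ->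
  (forall l, P l -> (q <= `|k - l|)%N) ->
  normc (partial_zmul P A B k j)
    <= C ^+ 2 * rho ^+ q * (4 / (1 - rho)).
Proof.
move=> r0 r1 dA dB hc.
apply: (zlim_le (partial_zmul_zlim P k j r0 r1 dA dB)
   (partial_zmul_dominated j r0 r1 dA dB hc)) => N.
by apply: zpsum_weight_le => //; rewrite mulr_ge0 ?sqr_ge0 ?exprn_ge0// ltW.
Qed.

(** Associativity for a bounded row g: if g A vanishes on the columns in P, then
    so does g times the partial product.  The weight rho^|k-l| rho^|l-j| is not a
    product of a function of k and one of l; with s the square root of rho it is
    at most s^|k-j| s^|l-j|, which is one, as required by [zlim_exchange]. *)
Lemma partial_zmul_annihilated (R : realType) (C M rho : R) (A B : zmatrix R)
    (g : int -> R[i]) (P : int -> bool) (j : int) :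
  0 < rho -> rho < 1 -> exp_decay C rho A -> exp_decay C rho B ->
  (forall k, normc (g k) <= M) ->
  (forall l, P l -> zlim (fun k => g k * A k l) 0) ->
  zlim (fun k => g k * partial_zmul P A B k j) 0.
Proof.
move=> r0 r1 dA dB gM gA.
have M0 : 0 <= M := le_trans (normc_ge0 _) (gM 0).
set s := Num.sqrt rho.
have s0 : 0 < s by rewrite sqrtr_gt0.
have s0' := ltW s0.
have s1 : s < 1 by rewrite -sqrtr1 ltr_sqrt.
have ss : rho = s ^+ 2 by rewrite sqr_sqrtr ?ltW.
apply: (@zlim_exchange _
  (fun k l => g k * (if P l then A k l * B l j else 0)) _ (fun=> 0)
  (fun k => M * C ^+ 2 * s ^+ `|k - j|%N) (fun l => 1 * s ^+ `|l - j|%N)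
  (M * C ^+ 2 * (4 / (1 - s))) (1 * (4 / (1 - s)))).
- move=> k l; rewrite normcM -(mulrA (M * C ^+ 2)) -(mulrA M) ler_pM ?normc_ge0//.
  case: ifP => _.
    apply: le_trans (exp_decay_mul_le k l j dA dB) _.
    rewrite ler_wpM2l ?sqr_ge0// mul1r ss -!exprM -!exprD.
    by apply: ler_wiXn2l => //; [exact: ltW | lia].
  by rewrite normc0 mulr_ge0 ?sqr_ge0// !mulr_ge0 ?exprn_ge0.
- by move=> k; rewrite -mulrA mulr_ge0// mulr_ge0 ?sqr_ge0 ?exprn_ge0.
- by move=> k; rewrite !mulr_ge0 ?exprn_ge0.
- by move=> N; apply: zpsum_weight_le => //; rewrite mulr_ge0 ?sqr_ge0.
- by move=> N; apply: zpsum_weight_le.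
- by move=> k; exact: zlimZ (partial_zmul_zlim P k j r0 r1 dA dB).
- move=> l; case Pl: (P l).
    under eq_fun do rewrite mulrA mulrC.
    by have := zlimZ (B l j) (gA l Pl); rewrite mulr0.
  by under eq_fun do rewrite mulr0; exact: zlim0.
- exact: zlim0.
Qed.

Lemma zmul_block (R : realType) (n p s t s' : nat) (A B : zmatrix R) (k j : int) :
  in_block n p s k -> in_block n p s' j ->
  zmul (block n p s t A) (block n p t s' B) k j =
  partial_zmul (in_block n p t) A B k j.
Proof.
move=> sk sj; congr zsum; apply/funext => l.
by rewrite /block sk sj andbT /=; case: ifP => _//; rewrite mul0r.
Qed.

(** * Perturbation of finite matrices with small entries *)

Lemma normc_mulmx_le (R : realType) (a m q : nat) (e : R)
    (Y : 'M[R[i]]_(a, m)) (E : 'M[R[i]]_(m, q)) (i : 'I_a) (j : 'I_q) :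
  (forall r s, normc (E r s) <= e) ->
  normc ((Y *m E) i j) <= e * \sum_t normc (Y i t).
Proof.
move=> Ee; rewrite mxE; apply: le_trans (normc_sum _ _ _) _.
rewrite mulr_sumr; apply: ler_sum => t _.
by rewrite normcM mulrC ler_wpM2r ?normc_ge0.
Qed.

Lemma sum_le_card (R : realType) (m : nat) (b : R) (F : 'I_m -> R) :
  (forall i, F i <= b) -> \sum_i F i <= m%:R * b.
Proof.
move=> Fb; apply: le_trans (ler_sum _ (fun i _ => Fb i)) _.
by rewrite sumr_const card_ord mulr_natl.
Qed.

Lemma l2norm_ge0 (R : realType) (m : nat) (x : 'cV[R[i]]_m) : 0 <= l2norm x.
Proof. exact: sqrtr_ge0. Qed.

Lemma opnorm_le (R : realType) (m : nat) (e : R) (E : 'M[R[i]]_m) :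
  0 <= e -> (forall r s, normc (E r s) <= e) ->
  0 <= opnorm E <= m%:R ^+ 2 * e.
Proof.
move=> e0 Ee.
set S := [set l2norm (E *m x) | x in [set x : 'cV[R[i]]_m | l2norm x <= 1]].
have ubS : ubound S (m%:R ^+ 2 * e).
  move=> _ [x /= x1 <-].
  have xi i : normc (x i ord0) <= 1.
    apply: le_trans x1; rewrite -[leLHS](ger0_norm (normc_ge0 _)) -sqrtr_sqr.
    rewrite ler_sqrt; last by apply: sumr_ge0 => ? _; rewrite sqr_ge0.
    by rewrite (bigD1 i)//= lerDl sumr_ge0// => ? _; rewrite sqr_ge0.
  have Exi i : normc ((E *m x) i ord0) <= m%:R * e.
    rewrite mxE; apply: le_trans (normc_sum _ _ _) _; apply: sum_le_card => j.
    by rewrite normcM -[leRHS]mulr1 ler_pM ?normc_ge0.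
  have me0 : 0 <= m%:R * e by rewrite mulr_ge0.
  have m2e0 : 0 <= m%:R ^+ 2 * e by rewrite mulr_ge0 ?sqr_ge0.
  rewrite -[leRHS](ger0_norm m2e0) -sqrtr_sqr /l2norm ler_sqrt ?sqr_ge0//.
  apply: (@le_trans _ _ (m%:R * (m%:R * e) ^+ 2)).
    by apply: sum_le_card => i; rewrite ler_sqr ?nnegrE ?normc_ge0.
  have -> : (m%:R ^+ 2 * e) ^+ 2 = m%:R ^+ 2 * (m%:R * e) ^+ 2 by ring.
  apply: ler_wpM2r; first exact: sqr_ge0.
  case: (m) => [|m']; first by rewrite expr0n.
  by rewrite ler_eXnr// ler1n.
have S0 : S (l2norm (E *m 0)).
  exists 0 => //=; rewrite /l2norm big1 ?sqrtr0// => i _.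
  by rewrite mxE normc0 expr0n.
apply/andP; split.
  apply: le_trans (l2norm_ge0 (E *m 0)) _.
  by apply: ub_le_sup => //; exists (m%:R ^+ 2 * e).
by apply: ge_sup => //; exists (l2norm (E *m 0)).
Qed.

(** In the l^1 norm, right multiplication by E has norm at most m e <= 1/2.  With
    x = 0 this says that 1 + E is injective; with x a row of an approximate
    inverse it bounds the rows of the inverse. *)
Lemma row_perturbation_le (R : realType) (m : nat) (e : R) (E : 'M[R[i]]_m)
    (x y : 'rV[R[i]]_m) :
  (forall r s, normc (E r s) <= e) -> m%:R * e <= 2^-1 -> y = x - y *m E ->
  \sum_t normc (y ord0 t) <= 2 * \sum_t normc (x ord0 t).
Proof.
move=> Ee me yE; set sy := \sum_t _; set sx := \sum_t _.
have sy0 : 0 <= sy by apply: sumr_ge0 => ? _; exact: normc_ge0.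
suff : sy <= sx + 2^-1 * sy by lra.
apply: (@le_trans _ _ (sx + m%:R * (e * sy))); last first.
  by rewrite lerD2l mulrA ler_wpM2r.
apply: (@le_trans _ _ (\sum_t (normc (x ord0 t) + normc ((y *m E) ord0 t)))).
  apply: ler_sum => t _; rewrite {1}yE !mxE.
  by apply: le_trans (le_normcD _ _) _; rewrite normcN.
rewrite big_split/= lerD2l; apply: sum_le_card => t; exact: normc_mulmx_le.
Qed.

(** Put E = G X - 1 and Y = G^-1.  From Y (1 + E) = X one gets Y - X = - Y E, and
    the rows of Y are at most twice as large in l^1 norm as those of X. *)
Lemma approx_right_inverse (R : realType) (m : nat) (e b : R)
    (G X : 'M[R[i]]_m) :
  0 <= e -> (forall r s, normc ((G *m X - 1%:M) r s) <= e) ->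
  (forall r s, normc (X r s) <= b) -> m%:R * e <= 2^-1 ->
  G \in unitmx /\
  forall r s, normc ((invmx G - X) r s) <= 2 * m%:R * b * e.
Proof.
move=> e0 Ee Xb me; set E := G *m X - 1%:M in Ee.
have GX : G *m X = 1%:M + E by rewrite /E addrC subrK.
have uGX : G *m X \in unitmx.
  rewrite -row_free_unit -kermx_eq0; apply/eqP/row_matrixP => r.
  set y := row r (kermx (G *m X)); rewrite row0.
  have yE : y = 0 - y *m E.
    have : y *m (G *m X) = 0 by rewrite /y -row_mul mulmx_ker row0.
    by rewrite GX mulmxDr mulmx1 sub0r => /eqP; rewrite addr_eq0 => /eqP.
  have := row_perturbation_le Ee me yE.
  rewrite [X in _ <= 2 * X]big1 ?mulr0; last by move=> t _; rewrite mxE normc0.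
  move=> sy; apply/rowP => t; rewrite [RHS]mxE; apply: eq0_normc; apply/eqP.
  rewrite eq_le normc_ge0 andbT; apply: le_trans sy.
  by rewrite (bigD1 t)//= lerDl sumr_ge0// => ? _; exact: normc_ge0.
have uG : G \in unitmx by move: uGX; rewrite unitmx_mul => /andP[].
split=> // r s; set Y := invmx G.
have YE : Y = X - Y *m E.
  have : Y *m (G *m X) = X by rewrite mulmxA mulVmx// mul1mx.
  by rewrite GX mulmxDr mulmx1 => <-; rewrite addrK.
have -> : Y - X = - (Y *m E) by rewrite {1}YE addrAC subrr sub0r.
rewrite mxE normcN; apply: le_trans (normc_mulmx_le _ _ _ Ee) _.
rewrite mulrC ler_wpM2r// -mulrA.
have rYE : row r Y = row r X - row r Y *m E by rewrite {1}YE raddfB/= row_mul.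
have := row_perturbation_le Ee me rYE.
under eq_bigr do rewrite mxE.
move=> h; apply: le_trans h _; rewrite ler_wpM2l//.
by apply: sum_le_card => t; rewrite mxE.
Qed.

(** * The corrected inverse *)

Lemma in_block2_idx22 (n p : nat) (r : 'I_(n + p)) : in_block n p 2 (idx22 r).
Proof. by case: r => r rnp; rewrite /in_block /idx22/=; lia. Qed.

Definition corrected_inverse (R : realType) (n p : nat)
    (Ginv Ups1 Lam1 Lam2 Ups2 : zmatrix R) : zmatrix R :=
  fun k j => Ginv k j - partial_zmul (in_block n p 3) Ups1 Lam1 k j
    - partial_zmul (in_block n p 1) Lam2 Ups2 k j.

(** On rows k < -p the lower triangular Lam2 only sees columns l < -p, so the
    second correction is all of Ginv. *)
Lemma corrected_inverse_left (R : realType) (n p : nat)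
    (Ginv Ups1 Lam1 Lam2 Ups2 : zmatrix R) (k j : int) :
  lower_tri Lam2 -> is_zmul Lam2 Ups2 Ginv -> k < - p%:Z ->
  corrected_inverse n p Ginv Ups1 Lam1 Lam2 Ups2 k j =
  - partial_zmul (in_block n p 3) Ups1 Lam1 k j.
Proof.
move=> low GE kp; rewrite /corrected_inverse.
suff <- : Ginv k j = partial_zmul (in_block n p 1) Lam2 Ups2 k j.
  by rewrite addrAC subrr sub0r.
rewrite -(GE k j).2; congr zsum; apply/funext => l; case: ifPn => //= lp.
by rewrite low ?mul0r//; lia.
Qed.

(** On rows k >= n the upper triangular Ups1 only sees columns l >= n, so the
    first correction is all of Ginv. *)
Lemma corrected_inverse_right (R : realType) (n p : nat)
    (Ginv Ups1 Lam1 Lam2 Ups2 : zmatrix R) (k j : int) :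
  upper_tri Ups1 -> is_zmul Ups1 Lam1 Ginv -> n%:Z <= k ->
  corrected_inverse n p Ginv Ups1 Lam1 Lam2 Ups2 k j =
  - partial_zmul (in_block n p 1) Lam2 Ups2 k j.
Proof.
move=> up GE kn; rewrite /corrected_inverse.
suff <- : Ginv k j = partial_zmul (in_block n p 3) Ups1 Lam1 k j.
  by rewrite subrr sub0r.
rewrite -(GE k j).2; congr zsum; apply/funext => l; case: ifPn => //= lp.
by rewrite up ?mul0r//; lia.
Qed.

(** The corrected inverse is an exact right inverse of the rows of G in block 2
    when the product runs over all of Z, so the error of the truncated product is
    the sum over the rows outside block 2, where only one correction is left. *)
Lemma truncated_product_error (R : realType) (n p : nat)
    (G Ginv L1 U2 Lam1 Lam2 Ups1 Ups2 : zmatrix R) (C rho : R)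
    (r s : 'I_(n + p)) :
  0 < rho -> rho < 1 ->
  lower_tri L1 -> upper_tri U2 -> upper_tri Ups1 -> lower_tri Lam2 ->
  is_zmul G Ups1 L1 -> is_zmul G Lam2 U2 -> is_zmul G Ginv (zone R) ->
  is_zmul Ups1 Lam1 Ginv -> is_zmul Lam2 Ups2 Ginv ->
  exp_decay C rho Lam1 -> exp_decay C rho Lam2 ->
  exp_decay C rho Ups1 -> exp_decay C rho Ups2 ->
  (forall i k, in_block n p 2 i -> ~~ in_block n p 2 k -> normc (G i k) <= C) ->
  normc ((mx22 n p G *m
    mx22 n p (corrected_inverse n p Ginv Ups1 Lam1 Lam2 Ups2) - 1%:M) r s)
  <= C ^+ 3 * (4 / (1 - rho)) * rho ^+ p * (2 * (4 / (1 - rho))).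
Proof.
move=> r0 r1 L1low U2up Ups1up Lam2low GU GL GGi GiUL GiLU dLam1 dLam2 dUps1
  dUps2 Gout.
set T := corrected_inverse n p Ginv Ups1 Lam1 Lam2 Ups2.
set K := 4 / (1 - rho).
have K0 : 0 <= K by rewrite divr_ge0// subr_ge0 ltW.
have r0' := ltW r0.
set i := idx22 r; set j := idx22 s.
have iB : in_block n p 2 i by exact: in_block2_idx22.
have jB : in_block n p 2 j by exact: in_block2_idx22.
have C0 : 0 <= C.
  by apply: le_trans (normc_ge0 _) (Gout i (n%:Z) iB _) => /=; lia.
(* C bounds the row off block 2, the finite sum bounds it inside. *)
have [M GM] : exists M, forall k, normc (G i k) <= M.
  exists (C + \sum_(t < n + p) normc (G i (idx22 t))) => k.
  have S0 (P : pred 'I_(n + p)) : 0 <= \sum_(t | P t) normc (G i (idx22 t)).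
    by apply: sumr_ge0 => ? _; exact: normc_ge0.
  case kB: (in_block n p 2 k); last first.
    by apply: le_trans (Gout i k iB _) _; rewrite ?kB// lerDl.
  have tP : (absz (k + p%:Z)%R < n + p)%N by move: kB => /=; lia.
  rewrite (bigD1 (Ordinal tP))//= (_ : idx22 _ = k); last first.
    by rewrite /idx22/=; move: kB => /=; lia.
  by rewrite addrCA lerDl addr_ge0.
have GT : zlim (fun k => G i k * T k j) (i == j)%:R.
  have hv : zlim (fun k => G i k * partial_zmul (in_block n p 3) Ups1 Lam1 k j) 0.
    apply: (partial_zmul_annihilated j r0 r1 dUps1 dLam1 GM) => l l3.
    rewrite -(L1low i l); first exact: is_zmul_zlim.
    by move: iB l3 => /=; lia.
  have hw : zlim (fun k => G i k * partial_zmul (in_block n p 1) Lam2 Ups2 k j) 0.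
    apply: (partial_zmul_annihilated j r0 r1 dLam2 dUps2 GM) => l l1.
    rewrite -(U2up i l); first exact: is_zmul_zlim.
    by move: iB l1 => /=; lia.
  have := zlimB (zlimB (is_zmul_zlim i j GGi) hv) hw.
  rewrite !subr0; congr zlim; apply/funext => k.
  by rewrite /T /corrected_inverse !mulrBr.
have GTin := zlim_window n p (fun k => G i k * T k j).
have := zlimB GTin GT.
have -> : \sum_(t < n + p) G i (idx22 t) * T (idx22 t) j - (i == j)%:R =
    (mx22 n p G *m mx22 n p T - 1%:M) r s.
  have -> : (i == j) = (r == s).
    apply/eqP/eqP => [|rs]; last by rewrite /i /j rs.
    by rewrite /i /j /idx22 => /addIr [rs]; exact: val_inj.
  by rewrite !mxE; congr (_ - _); apply: eq_bigr => t _; rewrite !mxE.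
have c3K : 0 <= C ^+ 3 * K by rewrite mulr_ge0 ?exprn_ge0.
have c3Kp : 0 <= C ^+ 3 * K * rho ^+ p by rewrite mulr_ge0 ?exprn_ge0.
move=> h; apply: (zlim_le (a := fun k => C ^+ 3 * K * rho ^+ p *
   (rho ^+ `|k - - p%:Z|%N + rho ^+ `|k - n%:Z|%N)) h) => [k|N]; last first.
  rewrite zpsumZ zpsumD ler_wpM2l//.
  by rewrite mulr_natl mulr2n lerD// zpsum_two_sided_geometric_le.
have Kpos q : 0 <= C ^+ 3 * K * rho ^+ p * rho ^+ q.
  by rewrite mulr_ge0 ?exprn_ge0.
case kB: (in_block n p 2 k).
  by rewrite subrr normc0 mulrDr addr_ge0.
rewrite sub0r normcN normcM.
have Gk := Gout i k iB (negbT kB).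
have weaken (q : nat) (z : R[i]) : normc z <= C ^+ 2 * rho ^+ (p + q) * K ->
    normc (G i k) * normc z <= C ^+ 3 * K * rho ^+ p * rho ^+ q.
  move=> zq; apply: le_trans (ler_pM (normc_ge0 _) (normc_ge0 _) Gk zq) _.
  by rewrite exprD le_eqVlt; apply/orP; left; apply/eqP; ring.
rewrite mulrDr; case: (ltP k (- p%:Z)) => kp.
  rewrite /T corrected_inverse_left// normcN.
  apply: (@le_trans _ _ (C ^+ 3 * K * rho ^+ p * rho ^+ `|k - - p%:Z|%N)).
    by apply/weaken/partial_zmul_le => // l /=; lia.
  by rewrite lerDl.
have kn : n%:Z <= k by move: kB => /=; lia.
rewrite /T corrected_inverse_right// normcN.
apply: (@le_trans _ _ (C ^+ 3 * K * rho ^+ p * rho ^+ `|k - n%:Z|%N)).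
  by apply/weaken/partial_zmul_le => // l /=; lia.
by rewrite lerDr.
Qed.

Lemma corrected_inverse_le (R : realType) (n p : nat)
    (Ginv Lam1 Lam2 Ups1 Ups2 : zmatrix R) (C rho : R) (k j : int) :
  0 < rho -> rho < 1 -> is_zmul Ups1 Lam1 Ginv ->
  exp_decay C rho Lam1 -> exp_decay C rho Lam2 ->
  exp_decay C rho Ups1 -> exp_decay C rho Ups2 ->
  normc (corrected_inverse n p Ginv Ups1 Lam1 Lam2 Ups2 k j)
    <= 3 * (C ^+ 2 * (4 / (1 - rho))).
Proof.
move=> r0 r1 GiUL dLam1 dLam2 dUps1 dUps2.
have part P A B : exp_decay C rho A -> exp_decay C rho B ->
    normc (partial_zmul P A B k j) <= C ^+ 2 * (4 / (1 - rho)).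
  move=> dA dB; have := @partial_zmul_le _ C rho A B P k j 0 r0 r1 dA dB.
  by rewrite expr0 mulr1; apply.
(* The full product is the partial product over all indices. *)
have Ginvk : normc (Ginv k j) <= C ^+ 2 * (4 / (1 - rho)).
  by rewrite -(GiUL k j).2; exact: (part xpredT).
rewrite /corrected_inverse.
have h3 (x y z : R[i]) (b : R) : normc x <= b -> normc y <= b -> normc z <= b ->
    normc (x - y - z) <= 3 * b.
  move=> xb yb zb; have := le_normcD (x - y) (- z); have := le_normcD x (- y).
  by rewrite !normcN; lra.
by apply: h3 => //; exact: part.
Qed.

(** In a column of block 2 the product Lam2 Ups2 = Ginv has no term with l >= n,
    so removing the terms with l < -p leaves the product of the finite blocks. *)
Lemma corrected_inverse_LU (R : realType) (n p : nat)
    (Ginv Lam1 Lam2 Ups1 Ups2 : zmatrix R) (C rho : R) (r s : 'I_(n + p)) :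
  0 < rho -> rho < 1 -> upper_tri Ups2 -> is_zmul Lam2 Ups2 Ginv ->
  exp_decay C rho Lam2 -> exp_decay C rho Ups2 ->
  (mx22 n p (corrected_inverse n p Ginv Ups1 Lam1 Lam2 Ups2)
    - mx22 n p Lam2 *m mx22 n p Ups2) r s =
  - partial_zmul (in_block n p 3) Ups1 Lam1 (idx22 r) (idx22 s).
Proof.
move=> r0 r1 up GE dL dU.
set k := idx22 r; set j := idx22 s.
have jB : in_block n p 2 j by exact: in_block2_idx22.
have hw := partial_zmul_zlim (in_block n p 1) k j r0 r1 dL dU.
have h := zlimD (zlim_window n p (fun l => Lam2 k l * Ups2 l j)) hw.
have /(zlim_unique h) E : zlim (fun l => (if in_block n p 2 l then Lam2 k l * Ups2 l j
    else 0) + (if in_block n p 1 l then Lam2 k l * Ups2 l j else 0)) (Ginv k j).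
  have := is_zmul_zlim k j GE; congr zlim; apply/funext => l.
  case l2: (in_block n p 2 l); case l1: (in_block n p 1 l); move: l1 l2 jB => /= l1 l2 jB.
  - by lia.
  - by rewrite addr0.
  - by rewrite add0r.
  - by rewrite addr0 up ?mulr0//; lia.
have prod : (mx22 n p Lam2 *m mx22 n p Ups2) r s =
    \sum_(l < n + p) Lam2 k (idx22 l) * Ups2 (idx22 l) j.
  by rewrite mxE; apply: eq_bigr => l _; rewrite !mxE.
rewrite mxE [X in _ + X]mxE prod [X in X - _]mxE /corrected_inverse -/k -/j -E.
by ring.
Qed.

(** The mirror image: Ups1 Lam1 = Ginv has no term with l < -p in such a
    column. *)
Lemma corrected_inverse_UL (R : realType) (n p : nat)
    (Ginv Lam1 Lam2 Ups1 Ups2 : zmatrix R) (C rho : R) (r s : 'I_(n + p)) :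
  0 < rho -> rho < 1 -> lower_tri Lam1 -> is_zmul Ups1 Lam1 Ginv ->
  exp_decay C rho Lam1 -> exp_decay C rho Ups1 ->
  (mx22 n p (corrected_inverse n p Ginv Ups1 Lam1 Lam2 Ups2)
    - mx22 n p Ups1 *m mx22 n p Lam1) r s =
  - partial_zmul (in_block n p 1) Lam2 Ups2 (idx22 r) (idx22 s).
Proof.
move=> r0 r1 low GE dL dU.
set k := idx22 r; set j := idx22 s.
have jB : in_block n p 2 j by exact: in_block2_idx22.
have hv := partial_zmul_zlim (in_block n p 3) k j r0 r1 dU dL.
have h := zlimD (zlim_window n p (fun l => Ups1 k l * Lam1 l j)) hv.
have /(zlim_unique h) E : zlim (fun l => (if in_block n p 2 l then Ups1 k l * Lam1 l j
    else 0) + (if in_block n p 3 l then Ups1 k l * Lam1 l j else 0)) (Ginv k j).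
  have := is_zmul_zlim k j GE; congr zlim; apply/funext => l.
  case l2: (in_block n p 2 l); case l3: (in_block n p 3 l); move: l3 l2 jB => /= l3 l2 jB.
  - by lia.
  - by rewrite addr0.
  - by rewrite add0r.
  - by rewrite addr0 low ?mulr0//; lia.
have prod : (mx22 n p Ups1 *m mx22 n p Lam1) r s =
    \sum_(l < n + p) Ups1 k (idx22 l) * Lam1 (idx22 l) j.
  by rewrite mxE; apply: eq_bigr => l _; rewrite !mxE.
rewrite mxE [X in _ + X]mxE prod [X in X - _]mxE /corrected_inverse -/k -/j -E.
by ring.
Qed.

(** * Asymptotics in the size of the block *)

Lemma idx22_inj (n p : nat) : injective (@idx22 n p).
Proof. by move=> r s /addIr [rs]; exact: val_inj. Qed.

Lemma entry22_dist_le (R : realType) (n p : nat) (M N : 'M[R[i]]_(n + p))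
    (a b : int) (e : R) :
  0 <= e ->
  (forall r s, idx22 r = a -> idx22 s = b -> normc ((M - N) r s) <= e) ->
  normc (entry22 M a b - entry22 N a b) <= e.
Proof.
move=> e0 MN; rewrite /entry22.
have [r /eqP ra | no_r] := pickP (fun r : 'I_(n + p) => idx22 r == a); last first.
  by rewrite !big_pred0// subrr normc0.
have rE t : (idx22 t == a) = (t == r) by rewrite -ra (inj_eq (@idx22_inj n p)).
rewrite !(eq_bigl _ _ rE) !big_pred1_eq.
have [s /eqP sb | no_s] := pickP (fun s : 'I_(n + p) => idx22 s == b); last first.
  by rewrite !big_pred0// subrr normc0.
have sE t : (idx22 t == b) = (t == s) by rewrite -sb (inj_eq (@idx22_inj n p)).
rewrite !(eq_bigl _ _ sE) !big_pred1_eq.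
by have := MN r s ra sb; rewrite !mxE.
Qed.

(** With s the square root of r, p s^p is at most the geometric sum
    1 + s + ... + s^(p-1), so p r^p <= s^p / (1 - s). *)
Lemma cvg_natr_geometric (R : realType) (r : R) :
  0 < r -> r < 1 -> (fun p => p%:R * r ^+ p) @ \oo --> (0 : R).
Proof.
move=> r0 r1; set s := Num.sqrt r.
have s0 : 0 < s by rewrite sqrtr_gt0.
have s1 : s < 1 by rewrite -sqrtr1 ltr_sqrt.
have ss : r = s ^+ 2 by rewrite sqr_sqrtr ?ltW.
have h : (fun p => (1 - s)^-1 * s ^+ p) @ \oo --> (0 : R).
  have := @cvg_geometric R (1 - s)^-1 s; apply.
  by rewrite ger0_norm// ltW.
apply: (squeeze_cvgr _ (cvg_cst 0) h); near=> p => /=.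
rewrite mulr_ge0 ?exprn_ge0 ?(ltW r0)//= ss -exprM mul2n -addnn exprD mulrA.
rewrite ler_wpM2r ?exprn_ge0 ?(ltW s0)//.
apply: le_trans (sum_geometric_le p s0 s1).
rewrite mulr_natl -[X in _ *+ X]card_ord -sumr_const; apply: ler_sum => k _.
by apply: ler_wiXn2l; [exact: ltW | exact: ltW | exact/ltnW/ltn_ord].
Unshelve. all: by end_near. Qed.

Lemma eqO_sqr_geometric (R : realType) (rho c : R) (f : nat -> R) :
  0 < rho -> 0 <= c ->
  (\forall p \near \oo, 0 <= f p <= c * (p%:R ^+ 2 * rho ^+ p)) ->
  f =O_\oo (fun p : nat => p%:R ^+ 2 * rho ^+ p).
Proof.
move=> r0 c0 fc; apply/eqO_exP; exists (c + 1); first by rewrite ltr_wpDl.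
near=> p.
have /andP[f0 fle] : 0 <= f p <= c * (p%:R ^+ 2 * rho ^+ p) by near: p.
have g0 : 0 <= p%:R ^+ 2 * rho ^+ p by rewrite mulr_ge0 ?sqr_ge0 ?exprn_ge0// ltW.
rewrite !ger0_norm//; apply: le_trans fle _.
by rewrite ler_wpM2r// lerDl.
Unshelve. all: by end_near. Qed.

(** Triangularity confines the sum defining G_ik to block 1 when k < -p and to
    block 3 when k >= n. *)
Lemma off_block_le (R : realType) (n p : nat) (G L1 U1 U2 L2 : zmatrix R)
    (C : R) :
  upper_tri U1 -> lower_tri L2 -> is_zmul L1 U1 G -> is_zmul U2 L2 G ->
  (forall i j, normc (zmul (block n p 2 1 L1) (block n p 1 1 U1) i j) <= C) ->
  (forall i j, normc (zmul (block n p 2 3 U2) (block n p 3 3 L2) i j) <= C) ->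
  forall i k, in_block n p 2 i -> ~~ in_block n p 2 k -> normc (G i k) <= C.
Proof.
move=> up low GLU GUL b1 b3 i k iB kB.
case: (ltP k (- p%:Z)) => kp.
- have := b1 i k; rewrite zmul_block// -(GLU i k).2; congr (normc _ <= _).
  congr zsum; apply/funext => l; case: ifPn => //= lp.
  by rewrite up ?mulr0//; lia.
- have kn : n%:Z <= k by move: kB => /=; lia.
  have := b3 i k; rewrite zmul_block// -(GUL i k).2; congr (normc _ <= _).
  congr zsum; apply/funext => l; case: ifPn => //= lp.
  by rewrite low ?mulr0//; lia.
Qed.

Lemma mx22_corrected_inverse (R : realType) (n p : nat)
    (Ginv Lam1 Lam2 Ups1 Ups2 : zmatrix R) :
  mx22 n p Ginv
    - mx22 n p (zmul (block n p 2 3 Ups1) (block n p 3 2 Lam1))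
    - mx22 n p (zmul (block n p 2 1 Lam2) (block n p 1 2 Ups2)) =
  mx22 n p (corrected_inverse n p Ginv Ups1 Lam1 Lam2 Ups2).
Proof.
apply/matrixP => r s; rewrite !mxE !zmul_block //;
  exact: in_block2_idx22.
Qed.

Theorem proposition6p2 (R : realType) (n : nat)
    (G Ginv L1 L2 U1 U2 Lam1 Lam2 Ups1 Ups2 : zmatrix R) (C rho : R)
    (n_gt0 : (0 < n)%N)
    (L1_low : lower_tri L1) (L2_low : lower_tri L2)
    (U1_up : upper_tri U1) (U2_up : upper_tri U2)
    (Lam1_low : lower_tri Lam1) (Lam2_low : lower_tri Lam2)
    (Ups1_up : upper_tri Ups1) (Ups2_up : upper_tri Ups2)
    (L1_inv : is_zinv L1 Lam1) (L2_inv : is_zinv L2 Lam2)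
    (U1_inv : is_zinv U1 Ups1) (U2_inv : is_zinv U2 Ups2)
    (G_LU : is_zmul L1 U1 G) (G_UL : is_zmul U2 L2 G)
    (G_inv : is_zinv G Ginv)
    (Ginv_UL : is_zmul Ups1 Lam1 Ginv) (Ginv_LU : is_zmul Lam2 Ups2 Ginv)
    (assoc_LU : zassoc L1 U1 Ups1) (assoc_UL : zassoc U2 L2 Lam2)
    (C_gt0 : 0 < C) (rho_gt0 : 0 < rho) (rho_lt1 : rho < 1)
    (bound_LU : forall (p : nat) (i j : int), (0 < p)%N ->
       normc (zmul (block n p 2 1 L1) (block n p 1 1 U1) i j) <= C)
    (bound_UL : forall (p : nat) (i j : int), (0 < p)%N ->
       normc (zmul (block n p 2 3 U2) (block n p 3 3 L2) i j) <= C)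
    (bound_Lam1 : forall i j : int, normc (Lam1 i j) <= C * rho ^+ `|i - j|%N)
    (bound_Lam2 : forall i j : int, normc (Lam2 i j) <= C * rho ^+ `|i - j|%N)
    (bound_Ups1 : forall i j : int, normc (Ups1 i j) <= C * rho ^+ `|i - j|%N)
    (bound_Ups2 : forall i j : int, normc (Ups2 i j) <= C * rho ^+ `|i - j|%N) :
  [/\ (fun p : nat => opnorm
         (mx22 n p G *m
            (mx22 n p Ginv
             - mx22 n p (zmul (block n p 2 3 Ups1) (block n p 3 2 Lam1))
             - mx22 n p (zmul (block n p 2 1 Lam2) (block n p 1 2 Ups2)))
          - 1%:M))
        =O_\oo (fun p : nat => p%:R ^+ 2 * rho ^+ p),
      (\forall p \near \oo, mx22 n p G \in unitmx),
      (forall i j : nat, (0 < i)%N -> (0 < j)%N ->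
        (fun p : nat => normc
           (entry22 (invmx (mx22 n p G))
              (- p%:Z + i%:Z - 1) (- p%:Z + j%:Z - 1)
            - entry22 (mx22 n p Lam2 *m mx22 n p Ups2)
              (- p%:Z + i%:Z - 1) (- p%:Z + j%:Z - 1)))
          =O_\oo (fun p : nat => p%:R ^+ 2 * rho ^+ p))
    & (forall i j : nat, (0 < i)%N -> (0 < j)%N ->
        (fun p : nat => normc
           (entry22 (invmx (mx22 n p G)) (n%:Z - i%:Z) (n%:Z - j%:Z)
            - entry22 (mx22 n p Ups1 *m mx22 n p Lam1)
              (n%:Z - i%:Z) (n%:Z - j%:Z)))
          =O_\oo (fun p : nat => p%:R ^+ 2 * rho ^+ p)) ].
Proof.
have GU := zassoc_cancel assoc_LU G_LU U1_inv.
have GL := zassoc_cancel assoc_UL G_UL L2_inv.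
have rho0 := ltW rho_gt0.
have [K KE] : exists K, K = 4 / (1 - rho) by eexists.
have K0 : 0 <= K by rewrite KE divr_ge0// subr_ge0 ltW.
have C0 := ltW C_gt0.
have [c cE] : exists c, c = C ^+ 3 * K * (2 * K) by eexists.
have c0 : 0 <= c by rewrite cE; apply: mulr_ge0; apply: mulr_ge0 => //; exact: exprn_ge0.
have [d dE] : exists d, d = C ^+ 2 * K by eexists.
have d0 : 0 <= d by rewrite dE; apply: mulr_ge0 => //; exact: sqr_ge0.
set X := fun p => corrected_inverse n p Ginv Ups1 Lam1 Lam2 Ups2.
have error p r s : (0 < p)%N ->
    normc ((mx22 n p G *m mx22 n p (X p) - 1%:M) r s) <= c * rho ^+ p.
  move=> p0.
  have Gout := off_block_le U1_up L2_low G_LU G_UL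
    (fun i j => bound_LU p i j p0) (fun i j => bound_UL p i j p0).
  have := truncated_product_error r s rho_gt0 rho_lt1 L1_low U2_up Ups1_up
    Lam2_low GU GL G_inv.1 Ginv_UL Ginv_LU bound_Lam1 bound_Lam2 bound_Ups1
    bound_Ups2 Gout.
  by rewrite cE KE mulrAC.
have X_le p r s : normc (mx22 n p (X p) r s) <= 3 * d.
  by rewrite mxE dE KE; exact: (corrected_inverse_le _ _ _ _ rho_gt0 rho_lt1 Ginv_UL).
have size_le p : (0 < p)%N -> (n <= p)%N -> (n + p)%:R <= 2 * p%:R :> R.
  by move=> p0 np; rewrite -natrM ler_nat; lia.
have small : \forall p \near \oo, (n + p)%:R * (c * rho ^+ p) <= 2^-1.
  have h : (fun p => 2 * c * (p%:R * rho ^+ p)) @ \oo --> (0 : R).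
    by rewrite -(mulr0 (2 * c)); apply: cvgMr; exact: cvg_natr_geometric.
  have half : 0 < 2^-1 :> R by rewrite invr_gt0.
  move/cvgrPdist_lt : h => /(_ _ half) h; near=> p.
  have h1 : `|0 - 2 * c * (p%:R * rho ^+ p)| < 2^-1 by near: p.
  have p0 : (0 < p)%N by near: p; exact: nbhs_infty_gt.
  have np : (n <= p)%N by near: p; exact: nbhs_infty_ge.
  have cp0 : 0 <= 2 * c * (p%:R * rho ^+ p).
    by apply: mulr_ge0; apply: mulr_ge0 => //; exact: exprn_ge0.
  move: h1; rewrite sub0r normrN ger0_norm// => h1.
  apply: le_trans (ltW h1).
  rewrite [leRHS](_ : _ = 2 * p%:R * (c * rho ^+ p)); last by ring.
  rewrite ler_wpM2r ?size_le// mulr_ge0 ?exprn_ge0//.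
have inverse : \forall p \near \oo, mx22 n p G \in unitmx /\
    forall r s, normc ((invmx (mx22 n p G) - mx22 n p (X p)) r s)
      <= 12 * d * c * (p%:R ^+ 2 * rho ^+ p).
  near=> p.
  have p0 : (0 < p)%N by near: p; exact: nbhs_infty_gt.
  have np : (n <= p)%N by near: p; exact: nbhs_infty_ge.
  have sp : (n + p)%:R * (c * rho ^+ p) <= 2^-1 by near: p.
  have e0 : 0 <= c * rho ^+ p by rewrite mulr_ge0 ?exprn_ge0.
  have [uG YX] := approx_right_inverse e0 (fun r s => error p r s p0) (X_le p) sp.
  split=> // r s; apply: le_trans (YX r s) _.
  apply: (@le_trans _ _ (2 * (2 * p%:R) * (3 * d) * (c * rho ^+ p))).
    by rewrite ler_wpM2r// ler_wpM2r ?mulr_ge0// ler_wpM2l//; exact: size_le.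
  rewrite [leLHS](_ : _ = 12 * d * c * (p%:R * rho ^+ p)); last by ring.
  rewrite ler_wpM2l ?mulr_ge0// ler_wpM2r ?exprn_ge0//.
  by rewrite ler_eXnr// ler1n.
have entries (a b : nat -> int) (Z : forall p, 'M[R[i]]_(n + p)) (i : nat) :
    (\forall p \near \oo, forall r s : 'I_(n + p), idx22 r = a p ->
       normc ((mx22 n p (X p) - Z p) r s) <= d * rho ^+ (p - i)) ->
    (fun p : nat => normc (entry22 (invmx (mx22 n p G)) (a p) (b p)
       - entry22 (Z p) (a p) (b p)))
      =O_\oo (fun p : nat => p%:R ^+ 2 * rho ^+ p).
  move=> XZ; have di0 : 0 <= d / rho ^+ i by rewrite divr_ge0 ?exprn_ge0.
  have dc0 : 0 <= 12 * d * c by rewrite !mulr_ge0.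
  apply: (@eqO_sqr_geometric _ _ (12 * d * c + d / rho ^+ i)) => //; first exact: addr_ge0.
  near=> p.
  have p0 : (0 < p)%N by near: p; exact: nbhs_infty_gt.
  have ip : (i <= p)%N by near: p; exact: nbhs_infty_ge.
  have g0 : 0 <= p%:R ^+ 2 * rho ^+ p by rewrite mulr_ge0 ?sqr_ge0 ?exprn_ge0.
  rewrite normc_ge0/=; apply: entry22_dist_le => [|r s ra _].
    by rewrite mulr_ge0 ?addr_ge0.
  rewrite -(subrK (mx22 n p (X p)) (invmx _)) -addrA mxE.
  apply: le_trans (le_normcD _ _) _; rewrite mulrDl lerD//.
    by move: r s ra; near: p; apply: filterS inverse => p [_ h] r s _; exact: h.
  have : normc ((mx22 n p (X p) - Z p) r s) <= d * rho ^+ (p - i).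
    by move: r s ra; near: p; apply: filterS XZ => p h r s ra; exact: h.
  move=> h; apply: le_trans h _.
  have -> : rho ^+ (p - i) = rho ^+ p / rho ^+ i.
    by rewrite -{2}(subnK ip) exprD mulfK// expf_neq0// gt_eqF.
  rewrite [leLHS](_ : _ = d / rho ^+ i * rho ^+ p); last by ring.
  rewrite ler_wpM2l// ler_peMl ?exprn_ge0// exprn_ege1//.
  by rewrite ler1n.
split.
- apply: (@eqO_sqr_geometric _ _ (4 * c)) => //; first by rewrite mulr_ge0.
  near=> p.
  have p0 : (0 < p)%N by near: p; exact: nbhs_infty_gt.
  have np : (n <= p)%N by near: p; exact: nbhs_infty_ge.
  have e0 : 0 <= c * rho ^+ p by rewrite mulr_ge0 ?exprn_ge0.
  rewrite mx22_corrected_inverse.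
  have /andP[-> h] := opnorm_le e0 (fun r s => error p r s p0).
  apply: le_trans h _ => /=.
  rewrite [leRHS](_ : _ = (2 * p%:R) ^+ 2 * (c * rho ^+ p)); last by ring.
  by rewrite ler_wpM2r// ler_sqr ?nnegrE ?mulr_ge0//; exact: size_le.
- by apply: filterS inverse => p [].
- move=> i j _ _; apply: (entries _ _ _ i); near=> p => r s ra.
  have ip : (i <= p)%N by near: p; exact: nbhs_infty_ge.
  rewrite (corrected_inverse_LU Lam1 Ups1 r s rho_gt0 rho_lt1 Ups2_up Ginv_LU
    bound_Lam2 bound_Ups2) normcN.
  rewrite dE KE mulrAC; apply: partial_zmul_le => // l; rewrite ra /=; lia.
- move=> i j _ _; apply: (entries _ _ _ i); near=> p => r s ra.
  have ip : (i <= p)%N by near: p; exact: nbhs_infty_ge.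
  rewrite (corrected_inverse_UL Lam2 Ups2 r s rho_gt0 rho_lt1 Lam1_low Ginv_UL
    bound_Lam1 bound_Ups1) normcN.
  rewrite dE KE mulrAC; apply: partial_zmul_le => // l; rewrite ra /=; lia.
Unshelve. all: by end_near. Qed.
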